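(* Let $d\in\mathbb{N}$, $d\ge1$. For $\alpha>0$ let $$L(\alpha)=\max_{\tau\ge\alpha\vee 1/\alpha}\left[\ln(1+\tau)-\frac{\tau-\alpha}{1+\tau}\ln(\alpha\tau)\right],$$ and let $0<a<b<\infty$ and $M=\left(\frac{b}{b-a}\right)^{d/2}\exp\left[\frac d2 L\left(\frac{a}{b-a}\right)\right]$. Then $$g_b(s,x,u,z)\,g_a(u,z,t,y)\le M\left[g_{b-a}(s,x,u,z)\vee g_a(u,z,t,y)\right]g_a(s,x,t,y)$$ for all $s<u<t$ and $x,z,y\in\mathbb{R}^d$. If $M$ in this inequality is replaced by any number smaller than $\left(\frac{b}{b-a}\right)^{d/2}\exp\left[\frac d2L\left(\frac{a}{b-a}\right)\right]$, then the inequality fails for some $s<u<t$ and $x,z,y\in\mathbb{R}^d$. Further, $$\left(\frac{b}{b-a}\right)^{d/2}\exp\left[\frac d2L\left(\frac{a}{b-a}\right)\right]=\left(1-\frac ab\right)^{-d}\quad\text{if}\quad \frac{1}{1+e^{-1/2}}\le\frac ab<1.$$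
   Context: For real numbers, $\alpha\vee\beta=\max\{\alpha,\beta\}$. For $a>0$, $s<t$ and $x,y\in\mathbb{R}^d$, the Gaussian kernel is $$g_a(s,x,t,y)=[4\pi(t-s)/a]^{-d/2}\exp\{-|y-x|^2/[4(t-s)/a]\},$$ and $g_a(s,x,t,y)=0$ if $s\ge t$. *)

(* Defs.v *)
From HB Require Import structures.
From mathcomp Require Import all_boot all_order all_algebra.
From mathcomp Require Import all_classical all_reals all_analysis.

Set Implicit Arguments.
Unset Strict Implicit.
Unset Printing Implicit Defensive.

Import Order.TTheory GRing.Theory Num.Theory.
Import numFieldNormedType.Exports.

Local Open Scope classical_set_scope.
Local Open Scope ring_scope.

(* The library norm on 'rV[R]_d is the sup norm, hence this definition. *)
Definition enorm (R : realType) (d : nat) (v : 'rV[R]_d) : R :=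
  Num.sqrt (\sum_(i < d) v ord0 i ^+ 2).

Definition gauss (R : realType) (d : nat) (a : R)
    (s : R) (x : 'rV[R]_d) (t : R) (y : 'rV[R]_d) : R :=
  if s < t then
    (4 * pi * (t - s) / a) `^ (- (d%:R / 2)) *
    expR (- (enorm (y - x) ^+ 2 / (4 * (t - s) / a)))
  else 0.

Definition Lexpr (R : realType) (alpha tau : R) : R :=
  ln (1 + tau) - (tau - alpha) / (1 + tau) * ln (alpha * tau).

Definition Lvals (R : realType) (alpha : R) : set R :=
  [set Lexpr alpha tau | tau in [set tau : R | Num.max alpha alpha^-1 <= tau]].

(* sup is a total operator (0 on unbounded sets); that Lmax alpha is the maximum
   of Lvals alpha for alpha > 0 is not part of this definition. *)
Definition Lmax (R : realType) (alpha : R) : R := sup (Lvals alpha).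

Definition is_max (R : realType) (A : set R) (m : R) : Prop :=
  A m /\ ubound A m.

Definition optM (R : realType) (d : nat) (a b : R) : R :=
  (b / (b - a)) `^ (d%:R / 2) * expR (d%:R / 2 * Lmax (a / (b - a))).

Definition ineq4G (R : realType) (d : nat) (a b M : R)
    (s u t : R) (x z y : 'rV[R]_d) : Prop :=
  gauss b s x u z * gauss a u z t y <=
  M * Num.max (gauss (b - a) s x u z) (gauss a u z t y) * gauss a s x t y.

(* Main.v *)
Require Import Defs.
From HB Require Import structures.
From mathcomp Require Import ring lra.
From mathcomp Require Import all_boot all_order all_algebra.
From mathcomp Require Import all_classical all_reals all_analysis.

Import Order.TTheory GRing.Theory Num.Theory.
Import numFieldNormedType.Exports.

Local Open Scope classical_set_scope.
Local Open Scope ring_scope.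

(** Put alpha = a/(b-a), tau = (u-s)/(t-u), h = d/2, and let A and B be the
logarithms of g_{b-a}(s,x,u,z) and g_a(u,z,t,y). For every lambda in [0,1],
max(A,B) >= lambda A + (1-lambda) B, so the logarithm of the quotient of the
two sides (without M) is at most a lambda-dependent expression in which the
logarithmic terms and the squared distances separate
([lgauss_interpolation]). The squared distances enter through a quadratic
form in (z-x, y-z), and the bound is finite only when that form has the right
sign. Two choices of lambda give such a form for all vectors:

- lambda = 1, by the convexity of the squared norm with weights proportional
  to the times; the resulting bound h (ln(1+alpha) + ln(1+tau)) increases with
  tau, and at tau = max(alpha, 1/alpha) it is h (ln(1+alpha) + Lexpr alpha tau);
- lambda = (1+alpha)/(1+tau), which is at most 1 when tau >= alpha; the bound
  is then exactly h (ln(1+alpha) + Lexpr alpha tau).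

Using the first below max(alpha, 1/alpha) and the second above it yields the
constant ([lgauss_upper], [ineq4G_optM]).

The second bound is attained: the form is degenerate, with null vectors
z-x = alpha v and y-z = v, and along this line |v| can be tuned so that A = B,
which makes the inequality between max(A,B) and the convex combination an
equality ([lgauss_sharp]). Tuning requires tau > alpha; if the maximum defining
L(alpha) sits at tau = alpha, the constant is approached by letting tau decrease
to alpha ([Lmax_approx]).

That L(alpha) is a maximum follows from the extreme value theorem on a compact
interval, since Lexpr alpha stays below its value at T for all tau >= T once T
is large ([Lexpr_tail]). For alpha >= e^(1/2), which is the condition
a/b >= 1/(1+e^(-1/2)), the maximum is at tau = alpha by the inequality
1 + l <= e^l with l = ln((1+tau)/(1+alpha)) ([Lmax_ge_expR_half]); then
L(alpha) = ln(1+alpha), and 1 + alpha = 1/(1-a/b). *)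

(** * Logarithms *)

Lemma lnM_gt0 (R : realType) (x y : R) : 0 < x -> 0 < y ->
  ln (x * y) = ln x + ln y.
Proof. by move=> x0 y0; rewrite lnM ?posrE. Qed.

Lemma lnV_gt0 (R : realType) (x : R) : 0 < x -> ln x^-1 = - ln x.
Proof. by move=> x0; rewrite lnV ?posrE. Qed.

Lemma ln_le_subr1 (R : realType) (x : R) : 0 < x -> ln x <= x - 1.
Proof.
move=> x0; have := @le_ln1Dx R (x - 1).
by rewrite (_ : 1 + (x - 1) = x); [apply; lra|ring].
Qed.

(** * The function maximised by L *)

Lemma max_inv_gt0 (R : realType) (alpha tau : R) : 0 < alpha ->
  Num.max alpha alpha^-1 <= tau ->
  [/\ 0 < tau, alpha <= tau & 1 <= alpha * tau].
Proof.
move=> alpha0; rewrite ge_max => /andP[le1 le2]; split => //.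
  exact: lt_le_trans le1.
by rewrite mulrC -ler_pdivrMr // div1r.
Qed.

(** The coefficient of ln (alpha * tau) is rewritten as (1+alpha)/(1+tau) - 1,
which exhibits the interpolation weight of [lgauss_upper] and separates the
decreasing part ln (1+tau) - ln tau. *)
Lemma LexprE (R : realType) (alpha tau : R) : 0 < alpha -> 0 < tau ->
  Lexpr alpha tau = ln (1 + tau) - ln tau - ln alpha
                    + (1 + alpha) / (1 + tau) * (ln alpha + ln tau).
Proof.
move=> alpha0 tau0; rewrite /Lexpr lnM_gt0 //.
by field; rewrite lt0r_neq0 //; lra.
Qed.

Lemma Lexpr_max_inv (R : realType) (alpha : R) : 0 < alpha ->
  Lexpr alpha (Num.max alpha alpha^-1) = ln (1 + Num.max alpha alpha^-1).
Proof.
move=> alpha0; rewrite /Lexpr maxEle; case: ifP => _.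
  by rewrite divff ?gt_eqF // ln1 mulr0 subr0.
by rewrite subrr !mul0r subr0.
Qed.

Lemma Lexpr_continuous (R : realType) (alpha tau : R) :
  0 < alpha -> 0 < tau -> {for tau, continuous (Lexpr alpha)}.
Proof.
move=> alpha0 tau0.
have cD : (1 + t) @[t --> tau] --> 1 + tau.
  by apply: cvgD; [exact: cvg_cst|exact: cvg_id].
apply: cvgB.
  by apply: (cvg_comp _ _ cD); apply: continuous_ln; lra.
apply: cvgM.
  apply: cvgM; first by apply: cvgB; [exact: cvg_id|exact: cvg_cst].
  by apply: cvgV => //; rewrite lt0r_neq0 //; lra.
have cM : (alpha * t) @[t --> tau] --> alpha * tau.
  by apply: cvgM; [exact: cvg_cst|exact: cvg_id].
by apply: (cvg_comp _ _ cM); apply: continuous_ln; rewrite mulr_gt0.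
Qed.

(** In the form of [LexprE], ln(1+tau) - ln tau decreases, and
ln(alpha tau)/(1+tau) is at most its value at T: the tangent inequality
ln tau - ln T <= (tau-T)/T reduces this to (1+T)/T <= ln(alpha T), and
(1+T)/T <= 2. *)
Lemma Lexpr_tail (R : realType) (alpha T tau : R) : 0 < alpha -> 1 <= T ->
  2 <= ln (alpha * T) -> T <= tau -> Lexpr alpha tau <= Lexpr alpha T.
Proof.
move=> alpha0 T1; have T0 : 0 < T by lra.
rewrite lnM_gt0 // => lnT Ttau; have tau0 : 0 < tau by lra.
rewrite !LexprE //.
have D1 : 0 < 1 + tau by lra.
have D2 : 0 < 1 + T by lra.
have e1 : ln (1 + tau) - ln tau <= ln (1 + T) - ln T.
  rewrite -!ln_div ?posrE // ler_ln ?posrE ?divr_gt0 //.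
  rewrite ler_pdivrMr // mulrAC ler_pdivlMr //; nra.
have ratio : ln tau - ln T <= (tau - T) / T.
  rewrite -ln_div ?posrE //; apply: le_trans (ln_le_subr1 _ _ _) _.
    by rewrite divr_gt0.
  by rewrite mulrBl divff ?gt_eqF.
have e2 : (ln alpha + ln tau) * (1 + T) <= (ln alpha + ln T) * (1 + tau).
  have : (ln tau - ln T) * (1 + T) <= 2 * (tau - T).
    apply: le_trans (_ : (tau - T) / T * (1 + T) <= _).
      by rewrite ler_wpM2r //; lra.
    rewrite mulrAC ler_pdivrMr //; nra.
  nra.
have e3 : (1 + alpha) / (1 + tau) * (ln alpha + ln tau) <=
    (1 + alpha) / (1 + T) * (ln alpha + ln T).
  rewrite -!mulrA ler_wpM2l //; first by lra.
  by rewrite !(mulrC _^-1) ler_pdivrMr // mulrAC ler_pdivlMr.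
lra.
Qed.

Lemma is_max_sup (R : realType) (A : set R) (m : R) :
  is_max A m -> sup A = m.
Proof.
move=> [Am ubm]; apply/eqP; rewrite eq_le; apply/andP; split.
  by apply: ge_sup => //; exists m.
by apply: ub_le_sup => //; exists m.
Qed.

Lemma Lmax_is_max (R : realType) (alpha : R) : 0 < alpha ->
  is_max (Lvals alpha) (Lmax alpha).
Proof.
move=> alpha0; set m := Num.max alpha alpha^-1.
have [m0 _ _] := max_inv_gt0 _ _ _ alpha0 (lexx m).
(* One summand for each of m <= T, 1 <= T and 2 <= ln (alpha * T). *)
pose T := m + 1 + expR 2 / alpha.
have E0 : 0 < expR 2 / alpha :> R by rewrite divr_gt0 // expR_gt0.
have mT : m <= T by rewrite /T; lra.
have T1 : 1 <= T by rewrite /T; lra.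
have lnT : 2 <= ln (alpha * T).
  rewrite -[leLHS]expRK ler_ln ?posrE ?expR_gt0 ?mulr_gt0 //; last lra.
  rewrite mulrC -ler_pdivrMr // /T; lra.
have [|c] := @EVT_max R (Lexpr alpha) _ _ mT.
  apply: continuous_in_subspaceT => t; rewrite inE /= in_itv /= => /andP[mt _].
  by apply: Lexpr_continuous => //; lra.
rewrite in_itv /= => /andP[mc cT] maxc.
have cmax : is_max (Lvals alpha) (Lexpr alpha c).
  split; first by exists c.
  move=> _ [tau /= mtau <-]; have [tauT|/ltW Ttau] := leP tau T.
    by apply: maxc; rewrite in_itv /= mtau.
  apply: le_trans (Lexpr_tail _ _ _ _ alpha0 T1 lnT Ttau) _.
  by apply: maxc; rewrite in_itv /= mT lexx.
by rewrite /Lmax (is_max_sup _ _ _ cmax).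
Qed.

Lemma Lexpr_le_Lmax (R : realType) (alpha tau : R) : 0 < alpha ->
  Num.max alpha alpha^-1 <= tau -> Lexpr alpha tau <= Lmax alpha.
Proof.
by move=> alpha0 h; have [_] := Lmax_is_max _ _ alpha0; apply; exists tau.
Qed.

(** With l = ln((1+tau)/(1+alpha)), the claim Lexpr alpha tau <= ln(1+alpha) is
l <= (tau-alpha)/(1+tau) * ln(alpha tau). Here (tau-alpha)/(1+tau) = 1 - e^(-l)
and ln(alpha tau) = 2 ln alpha + ln(tau/alpha) >= 1 + l, so it suffices that
l <= (1 - e^(-l)) (1+l), that is, 1 + l <= e^l. *)
Lemma Lmax_ge_expR_half (R : realType) (alpha : R) : expR (1 / 2) <= alpha ->
  Lmax alpha = ln (1 + alpha).
Proof.
move=> le_alpha; have alpha0 : 0 < alpha := lt_le_trans (expR_gt0 _) le_alpha.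
have lnalpha : 1 / 2 <= ln alpha.
  by rewrite -[leLHS]expRK ler_ln ?posrE ?expR_gt0.
have alpha1 : 1 <= alpha.
  by have := expR_ge1Dx (1 / 2 : R); lra.
have maxE : Num.max alpha alpha^-1 = alpha.
  by apply/max_idPl; apply: le_trans (alpha1); rewrite invf_le1.
apply: is_max_sup; split.
  by exists alpha; rewrite /= ?maxE // -{2}maxE Lexpr_max_inv // maxE.
move=> _ [tau /= + <-]; rewrite maxE => le_tau.
have tau0 : 0 < tau by lra.
have D1 : 0 < 1 + tau by lra.
have D2 : 0 < 1 + alpha by lra.
pose l := ln (1 + tau) - ln (1 + alpha).
have lE : l = ln ((1 + tau) / (1 + alpha)) by rewrite ln_div ?posrE.
have l0 : 0 <= l by rewrite lE ln_ge0 // ler_pdivlMr //; lra.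
have l_le : l <= ln tau - ln alpha.
  rewrite lE -ln_div ?posrE // ler_ln ?posrE ?divr_gt0 //.
  rewrite ler_pdivrMr // mulrAC ler_pdivlMr //; nra.
have l_exp : 1 + l <= (1 + tau) / (1 + alpha).
  by have := ln_le_subr1 _ ((1 + tau) / (1 + alpha)) (divr_gt0 D1 D2); rewrite -lE; lra.
have key : l <= (tau - alpha) / (1 + tau) * (1 + l).
  move: l_exp; rewrite ler_pdivlMr // => l_exp.
  rewrite mulrAC ler_pdivlMr //; nra.
rewrite /Lexpr lnM_gt0 // lerBlDr -lerBlDl -/l; apply: le_trans key _.
by rewrite ler_wpM2l ?divr_ge0 //; lra.
Qed.

(** * Gaussian kernels on the logarithmic scale *)

(** Keeping h and N as free reals leaves an inequality between real numbers, in
which the dimension is only the factor h = d/2 and the points appear only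
through their squared distances N. *)
Definition lgauss (R : realType) (h c p N : R) : R :=
  h * (ln c - ln p - ln (4 * pi)) - c * N / (4 * p).
Arguments lgauss {R} h c p N.

Lemma gaussE (R : realType) (d : nat) (c s t : R) (x y : 'rV[R]_d) :
  0 < c -> s < t ->
  gauss c s x t y = expR (lgauss (d%:R / 2) c (t - s) (enorm (y - x) ^+ 2)).
Proof.
move=> c0 st; rewrite /gauss st; have p0 : 0 < t - s by lra.
have pi0 : 0 < 4 * pi :> R by rewrite mulr_gt0 ?pi_gt0.
have D0 : 0 < 4 * pi * (t - s) by rewrite mulr_gt0.
rewrite /powR gt_eqF ?divr_gt0 // -expRD; congr expR.
rewrite /lgauss ln_div ?posrE // lnM_gt0 //; field.
by rewrite !gt_eqF.
Qed.

Lemma expR_max (R : realType) (u v : R) :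
  Num.max (expR u) (expR v) = expR (Num.max u v).
Proof. by rewrite !maxEle ler_expR; case: ifP. Qed.

Lemma enorm_sqr (R : realType) (d : nat) (v : 'rV[R]_d) :
  enorm v ^+ 2 = \sum_(i < d) v ord0 i ^+ 2.
Proof. by rewrite sqr_sqrtr // sumr_ge0 // => i _; exact: sqr_ge0. Qed.

(** The deficit is the sum of the squares (v_i - k w_i)^2 / k; equality holds for
v = k w, the direction used for the lower bound. *)
Lemma enormD_sqr_le (R : realType) (d : nat) (k : R) (v w : 'rV[R]_d) :
  0 < k ->
  enorm (v + w) ^+ 2 <= (1 + k^-1) * enorm v ^+ 2 + (1 + k) * enorm w ^+ 2.
Proof.
move=> k0; rewrite !enorm_sqr !mulr_sumr -big_split /=.
apply: ler_sum => i _; rewrite mxE; set e := v _ _; set f := w _ _.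
rewrite -subr_ge0 (_ : _ - _ = k^-1 * (e - k * f) ^+ 2).
  by rewrite mulr_ge0 ?sqr_ge0 // invr_ge0 ltW.
by field; rewrite gt_eqF.
Qed.

(** * The logarithmic inequality *)

(** The parameters are normalised by the time q of the last step: the first step
takes time tau q, and b = a (1+alpha)/alpha, b - a = a/alpha. *)
Lemma lgauss_interpolation (R : realType) (h a alpha q tau lambda N1 N2 N3 : R) :
  0 < a -> 0 < alpha -> 0 < q -> 0 < tau ->
  lgauss h (a * (1 + alpha) / alpha) (tau * q) N1 + lgauss h a q N2
  - ((1 - lambda) * lgauss h a q N2
     + lambda * lgauss h (a / alpha) (tau * q) N1)
  - lgauss h a (tau * q + q) N3
  = h * (ln (1 + alpha) + ln (1 + tau) - (1 - lambda) * (ln alpha + ln tau))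
    - a / (4 * q) * ((1 + alpha - lambda) * N1 / (alpha * tau)
                     + lambda * N2 - N3 / (1 + tau)).
Proof.
move=> a0 alpha0 q0 tau0; have D0 : 0 < 1 + tau by lra.
have E0 : 0 < 1 + alpha by lra.
rewrite /lgauss (_ : tau * q + q = (1 + tau) * q); last ring.
rewrite !(lnM_gt0, lnV_gt0) ?invr_gt0 ?mulr_gt0 ?pi_gt0 //.
by field; rewrite !gt_eqF.
Qed.

(** The inequality assumed on N3 is used with the two weights k that make the
quadratic part of [lgauss_interpolation] nonnegative: k = tau for lambda = 1,
and k = alpha for lambda = (1+alpha)/(1+tau). *)
Lemma lgauss_upper (R : realType) (h a alpha q tau N1 N2 N3 : R) :
  0 <= h -> 0 < a -> 0 < alpha -> 0 < q -> 0 < tau ->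
  (forall k, 0 < k -> N3 <= (1 + k^-1) * N1 + (1 + k) * N2) ->
  lgauss h (a * (1 + alpha) / alpha) (tau * q) N1 + lgauss h a q N2 <=
  h * (ln (1 + alpha) + Lmax alpha)
  + Num.max (lgauss h (a / alpha) (tau * q) N1) (lgauss h a q N2)
  + lgauss h a (tau * q + q) N3.
Proof.
move=> h0 a0 alpha0 q0 tau0 N3_le.
have interp := fun l => @lgauss_interpolation R h a alpha q tau l N1 N2 N3
  a0 alpha0 q0 tau0.
have D0 : 0 < 1 + tau by lra.
have c0 : 0 < a / (4 * q) by rewrite divr_gt0 ?mulr_gt0.
set A := lgauss h (a / alpha) _ _ in interp *.
set B := lgauss h a q _ in interp *.
have maxA : A <= Num.max A B by rewrite le_max lexx.
have maxB : B <= Num.max A B by rewrite le_max lexx orbT.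
have [tau_le|/ltW le_tau] := leP tau (Num.max alpha alpha^-1).
  have bound : ln (1 + tau) <= Lmax alpha.
    apply: le_trans (Lexpr_le_Lmax _ _ _ alpha0 (lexx _)).
    by rewrite Lexpr_max_inv // ler_ln ?posrE //; lra.
  have := ler_wpM2l h0 bound.
  (* Below the threshold the weight lambda = 1 suffices: only A <= max is used. *)
  have := interp 1; rewrite subrr !(mul0r, add0r, subr0, mul1r).
  have : N3 / (1 + tau) <= alpha * N1 / (alpha * tau) + N2.
    rewrite ler_pdivrMr //; apply: le_trans (N3_le _ tau0) _.
    rewrite le_eqVlt; apply/orP; left; apply/eqP.
    by field; rewrite !gt_eqF.
  rewrite -(subr_ge0 (N3 / _)) => /(mulr_ge0 (ltW c0)).
  lra.
have [_ alpha_tau _] := max_inv_gt0 _ _ _ alpha0 le_tau.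
pose l := (1 + alpha) / (1 + tau).
have l0 : 0 <= l by rewrite divr_ge0 //; lra.
(* alpha <= tau is what makes l an admissible weight. *)
have l1 : 0 <= 1 - l by rewrite subr_ge0 ler_pdivrMr //; lra.
have bound := ler_wpM2l h0 (Lexpr_le_Lmax _ _ _ alpha0 le_tau).
have LE := LexprE _ _ _ alpha0 tau0; rewrite -/l in LE.
have mA := ler_wpM2l l0 maxA; have mB := ler_wpM2l l1 maxB.
have hl := interp l.
have : N3 / (1 + tau) <= (1 + alpha - l) * N1 / (alpha * tau) + l * N2.
  rewrite ler_pdivrMr //; apply: le_trans (N3_le _ alpha0) _.
  rewrite le_eqVlt; apply/orP; left; apply/eqP.
  by rewrite /l; field; rewrite !gt_eqF.
rewrite -(subr_ge0 (N3 / _)) => /(mulr_ge0 (ltW c0)).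
rewrite LE in bound.
nra.
Qed.

(** The squared distances alpha^2 n, n, (1+alpha)^2 n are those of collinear
steps alpha v and v, a null vector of the quadratic form. The value of n solves
the linear equation that makes the two logarithms in the maximum equal, namely
h ln(alpha tau) = a n (tau-alpha) / (4 tau). *)
Lemma lgauss_sharp (R : realType) (h a alpha tau : R) :
  0 <= h -> 0 < a -> 0 < alpha -> alpha < tau -> 1 <= alpha * tau ->
  exists2 n : R, 0 <= n &
    lgauss h (a * (1 + alpha) / alpha) tau (alpha ^+ 2 * n) + lgauss h a 1 n =
    h * (ln (1 + alpha) + Lexpr alpha tau)
    + Num.max (lgauss h (a / alpha) tau (alpha ^+ 2 * n)) (lgauss h a 1 n)
    + lgauss h a (tau + 1) ((1 + alpha) ^+ 2 * n).
Proof.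
move=> h0 a0 alpha0 alpha_tau at1; have tau0 : 0 < tau by lra.
have ta0 : 0 < tau - alpha by lra.
have D0 : 0 < 1 + tau by lra.
pose n := 4 * h * tau * ln (alpha * tau) / (a * (tau - alpha)).
exists n.
  by rewrite divr_ge0 ?mulr_ge0 ?ln_ge0 // ltW.
have := @lgauss_interpolation R h a alpha 1 tau ((1 + alpha) / (1 + tau))
  (alpha ^+ 2 * n) n ((1 + alpha) ^+ 2 * n) a0 alpha0 ltr01 tau0.
rewrite !mulr1.
have -> : lgauss h (a / alpha) tau (alpha ^+ 2 * n) = lgauss h a 1 n.
  rewrite /lgauss /n !lnM_gt0 ?lnV_gt0 ?invr_gt0 ?pi_gt0 // ln1.
  by field; rewrite !gt_eqF.
rewrite maxxx LexprE //.
set B := lgauss h a 1 n; set C := lgauss _ _ (tau + 1) _; set A := lgauss _ _ _ _.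
have -> : (1 + alpha - (1 + alpha) / (1 + tau)) * (alpha ^+ 2 * n) /
    (alpha * tau) + (1 + alpha) / (1 + tau) * n -
    (1 + alpha) ^+ 2 * n / (1 + tau) = 0.
  by field; rewrite !gt_eqF.
rewrite mulr0; lra.
Qed.

(** * The inequality, its sharpness and the closed form *)

Lemma optME (R : realType) (d : nat) (a alpha : R) : 0 < a -> 0 < alpha ->
  optM d a (a * (1 + alpha) / alpha) =
  expR (d%:R / 2 * (ln (1 + alpha) + Lmax alpha)).
Proof.
move=> a0 alpha0; rewrite /optM.
have -> : a * (1 + alpha) / alpha - a = a / alpha by field; rewrite gt_eqF.
have -> : a / (a / alpha) = alpha by field; rewrite !gt_eqF.
have -> : a * (1 + alpha) / alpha / (a / alpha) = 1 + alpha.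
  by field; rewrite !gt_eqF //; lra.
by rewrite /powR gt_eqF ?addr_gt0 // -expRD -mulrDr.
Qed.

(** Turns statements about (a,b) into statements about (a,alpha), where all the
kernel constants are products and have separate logarithms. *)
Lemma ratio_param (R : realType) (a b : R) : 0 < a -> a < b ->
  exists2 alpha : R, 0 < alpha & b = a * (1 + alpha) / alpha.
Proof.
move=> a0 ab; have ba0 : 0 < b - a by lra.
exists (a / (b - a)); first by rewrite divr_gt0.
by field; rewrite !gt_eqF.
Qed.

Lemma ineq4G_optM (R : realType) (d : nat) (a b s u t : R) (x z y : 'rV[R]_d) :
  0 < a -> a < b -> s < u -> u < t -> ineq4G a b (optM d a b) s u t x z y.
Proof.
move=> a0 ab su ut; have [alpha alpha0 bE] := ratio_param _ _ _ a0 ab.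
have ba : b - a = a / alpha by rewrite bE; field; rewrite gt_eqF.
have h0 : 0 <= d%:R / 2 :> R by rewrite divr_ge0.
have q0 : 0 < t - u by lra.
have tau0 : 0 < (u - s) / (t - u) by rewrite divr_gt0 //; lra.
have b0 : 0 < a * (1 + alpha) / alpha by rewrite divr_gt0 // mulr_gt0 //; lra.
rewrite /ineq4G ba {ba} bE optME // !gaussE ?b0 ?divr_gt0 ?(lt_trans su ut) //.
rewrite expR_max -!expRD ler_expR.
have pE : u - s = (u - s) / (t - u) * (t - u) by rewrite divfK ?gt_eqF.
have -> : t - s = u - s + (t - u) by ring.
rewrite pE; apply: lgauss_upper => // k k0.
have -> : y - x = (z - x) + (y - z) by rewrite [RHS]addrC addrA subrK.
exact: enormD_sqr_le.
Qed.

Lemma enorm_delta_sqr (R : realType) (d : nat) (i : 'I_d) (c : R) :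
  enorm (c *: delta_mx 0 i : 'rV[R]_d) ^+ 2 = c ^+ 2.
Proof.
rewrite enorm_sqr (bigD1 i) //= big1 => [|j /negbTE ji].
  by rewrite !mxE !eqxx mulr1 addr0.
by rewrite !mxE ji andbF mulr0 expr0n.
Qed.

(** In the configuration of [lgauss_sharp], placed on a coordinate axis, the left
side equals exp(h (ln(1+alpha) + Lexpr alpha tau)) times the positive factor
that multiplies M' on the right. *)
Lemma ineq4G_sharp (R : realType) (d : nat) (a alpha tau M' : R) :
  (1 <= d)%N -> 0 < a -> 0 < alpha -> alpha < tau -> 1 <= alpha * tau ->
  M' < expR (d%:R / 2 * (ln (1 + alpha) + Lexpr alpha tau)) ->
  exists (s u t : R) (x z y : 'rV[R]_d),
    [/\ s < u, u < t & ~ ineq4G a (a * (1 + alpha) / alpha) M' s u t x z y].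
Proof.
move=> d1 a0 alpha0 at1 at2 ltM.
have tau0 : 0 < tau by lra.
have h0 : 0 <= d%:R / 2 :> R by rewrite divr_ge0.
have [n n0 eqn] := lgauss_sharp _ _ _ _ _ h0 a0 alpha0 at1 at2.
pose e : 'rV[R]_d := delta_mx 0 (Ordinal d1); pose r := Num.sqrt n.
exists 0, tau, (tau + 1), 0, ((alpha * r) *: e), (((1 + alpha) * r) *: e).
split => //; first by lra.
rewrite /ineq4G (_ : a * (1 + alpha) / alpha - a = a / alpha); last first.
  by field; rewrite gt_eqF.
have b0 : 0 < a * (1 + alpha) / alpha by rewrite divr_gt0 // mulr_gt0 //; lra.
rewrite !gaussE ?b0 ?divr_gt0 ?ltrDl //; last lra.
rewrite !subr0 -scalerBl (_ : (1 + alpha) * r - alpha * r = r); last ring.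
rewrite !enorm_delta_sqr !exprMn sqr_sqrtr // (_ : tau + 1 - tau = 1); last ring.
rewrite expR_max -expRD eqn (expRD (_ + Num.max _ _)) (expRD (_ * _)).
apply/negP; rewrite -ltNge.
by rewrite ltr_pM2r ?expR_gt0 // ltr_pM2r ?expR_gt0.
Qed.

(** [ineq4G_sharp] needs alpha < tau, while the maximum may be attained at
tau = alpha; continuity then provides a point to the right. *)
Lemma Lmax_approx (R : realType) (alpha k M' : R) : 0 < alpha ->
  M' < expR (k * (ln (1 + alpha) + Lmax alpha)) ->
  exists tau, [/\ alpha < tau, 1 <= alpha * tau &
    M' < expR (k * (ln (1 + alpha) + Lexpr alpha tau))].
Proof.
move=> alpha0; have [[tau /= max_tau <-] _] := Lmax_is_max _ _ alpha0.
have [tau0 + at1] := max_inv_gt0 _ _ _ alpha0 max_tau.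
rewrite le_eqVlt => /predU1P[tauE|]; last by exists tau.
rewrite -tauE in at1 tau0 * => {tau max_tau tauE} ltM.
pose f t := expR (k * (ln (1 + alpha) + Lexpr alpha t)).
have cf : f t @[t --> alpha^'+] --> f alpha.
  have cg : k * (ln (1 + alpha) + Lexpr alpha t) @[t --> alpha] -->
      k * (ln (1 + alpha) + Lexpr alpha alpha).
    apply: cvgM; first exact: cvg_cst.
    by apply: cvgD; [exact: cvg_cst|exact: Lexpr_continuous].
  apply: cvg_at_right_filter; apply: (cvg_comp _ _ cg).
  exact: continuous_expR.
have : \forall t \near alpha^'+, alpha < t /\ M' < f t.
  by near=> t; split; near: t; [exact: nbhs_right_gt|exact: cvgr_gt cf _ ltM].
move=> /filter_ex[t [lt_t ltMt]]; exists t; split => //.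
by apply: le_trans at1 _; rewrite ler_wpM2l ?ltW.
Unshelve. all: by end_near. Qed.

Lemma optM_closed_form (R : realType) (d : nat) (a b : R) : 0 < a -> a < b ->
  1 / (1 + expR (- (1 / 2))) <= a / b -> optM d a b = (1 - a / b) ^- d.
Proof.
move=> a0 ab; have [alpha alpha0 ->] := ratio_param _ _ _ a0 ab.
have D0 : 0 < 1 + alpha by lra.
have -> : a / (a * (1 + alpha) / alpha) = alpha / (1 + alpha).
  by field; rewrite !gt_eqF.
have e0 : 0 < expR (1 / 2) :> R := expR_gt0 _.
rewrite expRN div1r => le_ab.
have le_alpha : expR (1 / 2) <= alpha.
  move: le_ab; rewrite (_ : 1 + (expR (1 / 2))^-1 = (1 + expR (1 / 2)) / expR (1 / 2)); last first.
    by field; rewrite gt_eqF.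
  rewrite invf_div ler_pdivrMr; last by lra.
  rewrite mulrAC ler_pdivlMr //; lra.
rewrite optME // Lmax_ge_expR_half //.
rewrite (_ : d%:R / 2 * _ = d%:R * ln (1 + alpha)); last by field.
rewrite expRM_natl lnK ?posrE // -exprVn; congr (_ ^+ d).
by field; rewrite !gt_eqF //; lra.
Qed.

Theorem theorem1p3 (R : realType) (d : nat) (d_ge1 : (1 <= d)%N) :
  (forall alpha : R, 0 < alpha -> is_max (Lvals alpha) (Lmax alpha)) /\
  (forall a b : R, 0 < a -> a < b ->
    [/\ (forall (s u t : R) (x z y : 'rV[R]_d), s < u -> u < t ->
          ineq4G a b (optM d a b) s u t x z y),
        (forall M' : R, M' < optM d a b ->
          exists (s u t : R) (x z y : 'rV[R]_d),
            [/\ s < u, u < t & ~ ineq4G a b M' s u t x z y])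
      & (1 / (1 + expR (- (1 / 2))) <= a / b -> a / b < 1 ->
          optM d a b = (1 - a / b) ^- d)]).
Proof.
split=> [alpha|a b a0 ab]; first exact: Lmax_is_max.
split=> [s u t x z y|M'|le_ab _]; first exact: ineq4G_optM.
  have [alpha alpha0 ->] := ratio_param _ _ _ a0 ab.
  rewrite optME // => /(Lmax_approx _ _ _ _ alpha0)[tau [lt_tau at1 ltM]].
  exact: ineq4G_sharp ltM.
exact: optM_closed_form.
Qed.
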